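(* Let $(R,\mathfrak{m},k)$ be a Noetherian local ring with infinite residue field $k$, let $I_1, \dotsc, I_n$ be a sequence of ideals of $R$, and let $I := \prod_{i=1}^n I_i$. Suppose that $d := \ell(I) \geq 1$, and that $\{a_{ij}\}$ and $\{b_{ij}\}$ are complete reductions of $I_1, \dotsc, I_n$ of type $d$. Then: (1) for almost all matrices $Z = \{z_{ij}\} \in R^{n \times d}$, the $n\times d$ matrix $\{a_{ij}^Z\}$ is a complete reduction of $I_1, \dotsc, I_n$, where $$a_{ij}^Z := \begin{cases} a_{ij} & \text{if } j < d, \\ \sum_{h=1}^d z_{ih} b_{ih} & \text{if } j = d; \end{cases}$$ (2) for almost all vectors $\mathbf{u} = \{u_j\} \in R^d$, the $n \times d$ matrix $\{a_{ij}^{\mathbf{u}}\}$ is a complete reduction of $I_1, \dotsc, I_n$, where $$a_{ij}^{\mathbf{u}} := \begin{cases} a_{ij} & \text{if } j < d, \\ \sum_{h=1}^d u_h b_{ih} & \text{if } j = d. \end{cases}$$ Here ''for almost all $Z \in R^{n\times d}$'' (resp. ''for almost all $\mathbf{u} \in R^d$'') means that there is a proper Zariski-closed subset $M \subsetneq k^{n \times d}$ (resp. $M \subsetneq k^d$) such that the assertion holds for every $Z$ (resp. $\mathbf{u}$) whose entrywise reduction modulo $\mathfrak{m}$ does not lie in $M$.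
   Context: All rings are commutative with identity. An ideal $J$ is a reduction of an ideal $I$ if $J \subseteq I \subseteq \overline{J}$, where $\overline{J}$ is the integral closure of $J$ (in a Noetherian ring, equivalently $J \subseteq I$ and $J I^m = I^{m+1}$ for some $m \ge 0$). The analytic spread of an ideal $I$ of a Noetherian local ring $(R,\mathfrak{m},k)$ is $\ell(I) := \dim \bigoplus_{m \geq 0} I^m/\mathfrak{m} I^m$ (Krull dimension of the fiber ring, with $I^0 = R$). A complete reduction of a sequence of ideals $I_1,\dotsc,I_n$ of type $r$ is an $n \times r$ matrix $\{a_{ij}\}$ such that $a_{ij} \in I_i$ for all $i,j$, and such that, setting $I := \prod_{i=1}^n I_i$ and $b_j := \prod_{i=1}^n a_{ij}$ for $1 \leq j \leq r$, the ideal $(b_1,\dotsc,b_r)$ is a reduction of $I$. A Zariski-closed subset of $k^N$ is the common zero locus in $k^N$ of a set of polynomials over $k$ in $N$ variables. *)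

(* Defs.v *)
From HB Require Import structures.
From mathcomp Require Import all_boot all_order all_algebra.
From mathcomp Require Import generic_quotient ring_quotient.
From mathcomp Require Import mathcomp_extra boolp classical_sets functions cardinality.
From mathcomp Require mpoly.

Set Implicit Arguments.
Unset Strict Implicit.
Unset Printing Implicit Defensive.

Import GRing.Theory.
Local Open Scope ring_scope.
Local Open Scope classical_set_scope.

Identity Coercion fun_of_set : set >-> Funclass.

(* The library's [idealr] structure only covers proper ideals, whereas R itself
   must be allowed here (as a factor, and as I^0). *)
Definition is_ideal (R : comNzRingType) (S : set R) : Prop :=
  [/\ S 0,
      forall x y, S x -> S y -> S (x + y) &
      forall a x, S x -> S (a * x)].

Record ideal (R : comNzRingType) := Ideal {
  ideal_set :> set R;
  ideal_setP : is_ideal ideal_set }.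

Section IdealTheory.
Variable R : comNzRingType.
Implicit Types (S : set R) (I J K : ideal R).

Lemma ideal_eq I J : ideal_set I = J -> I = J.
Proof.
by case: I J => [I hI] [J hJ] /= e; case: _ / e hJ => hJ; congr Ideal.
Qed.

Lemma ideal0 I : I 0. Proof. by case: (ideal_setP I). Qed.

Lemma idealD I x y : I x -> I y -> I (x + y).
Proof. by case: (ideal_setP I) => _ + _; apply. Qed.

Lemma idealMl I a x : I x -> I (a * x).
Proof. by case: (ideal_setP I) => _ _; apply. Qed.

Lemma idealN I x : I x -> I (- x).
Proof. by rewrite -mulN1r; apply: idealMl. Qed.

Lemma ideal_sum (T : Type) (r : seq T) (P : pred T) (F : T -> R) I :
  (forall i, P i -> I (F i)) -> I (\sum_(i <- r | P i) F i).
Proof. by move=> h; elim/big_ind: _ => //; [exact: ideal0|exact: idealD]. Qed.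

Lemma smallest_is_ideal S : is_ideal (smallest (@is_ideal R) S).
Proof.
split=> [A [[]]|x y hx hy A hA|a x hx A hA] //.
- by have [[_ h _] _] := hA; apply: h; [exact: hx|exact: hy].
- by have [[_ _ h] _] := hA; apply: h; exact: hx.
Qed.

Definition ideal_gen S : ideal R := Ideal (smallest_is_ideal S).

Lemma is_ideal_setT : is_ideal [set: R]. Proof. by []. Qed.

Definition unit_ideal : ideal R := Ideal is_ideal_setT.

Definition ideal_mul I J : ideal R := ideal_gen [set x * y | x in I & y in J].

Definition ideal_exp I m : ideal R := iter m (ideal_mul I) unit_ideal.

Definition ideal_prod n (I : 'I_n -> ideal R) : ideal R :=
  \big[ideal_mul/unit_ideal]_(i < n) I i.

Lemma mem_ideal_mul I J x y : I x -> J y -> ideal_mul I J (x * y).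
Proof. by move=> hx hy; apply: sub_gen_smallest; exists x => //; exists y. Qed.

Lemma ideal_mul_sub I J K :
  (forall x y, I x -> J y -> K (x * y)) -> ideal_mul I J `<=` K.
Proof.
move=> h; apply: (smallest_sub (ideal_setP K)).
by move=> _ [x hx [y hy <-]]; exact: h.
Qed.

(* [colon_ideal S K] = (K : S), used to run inductions on generators. *)
Lemma colon_is_ideal S K : is_ideal [set x | forall y, S y -> K (x * y)].
Proof.
split=> [y _|x y hx hy z hz|a x hx z hz] /=; first by rewrite mul0r; exact: ideal0.
- by rewrite mulrDl; apply: idealD; [exact: hx|exact: hy].
- by rewrite -mulrA; apply: idealMl; exact: hx.
Qed.

Definition colon_ideal S K : ideal R := Ideal (colon_is_ideal S K).

Lemma ideal_mulMr I J K x y : ideal_mul I J x -> K y ->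
  ideal_mul I (ideal_mul J K) (x * y).
Proof.
move=> hx hy.
suff h : ideal_mul I J `<=` colon_ideal K (ideal_mul I (ideal_mul J K)).
  exact: h hy.
apply: ideal_mul_sub => u v hu hv z hz /=; rewrite -mulrA.
exact: mem_ideal_mul hu (mem_ideal_mul hv hz).
Qed.

Lemma ideal_mulSr I J K : J `<=` K -> ideal_mul I J `<=` ideal_mul I K.
Proof. by move=> h; apply: ideal_mul_sub => x y hx /h; exact: mem_ideal_mul. Qed.

Lemma ideal_expM I i j x y :
  ideal_exp I i x -> ideal_exp I j y -> ideal_exp I (i + j) (x * y).
Proof.
elim: i x y => [|i IH] x y hx hy; first exact: idealMl.
rewrite addSn /=; have := ideal_mulMr hx hy.
apply: ideal_mulSr.
by apply: ideal_mul_sub => u v; exact: IH.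
Qed.

Definition prime_ideal I : Prop :=
  ~ I 1 /\ forall x y, I (x * y) -> I x \/ I y.

Definition maximal_ideal I : Prop :=
  ~ I 1 /\ forall J, I `<=` J -> J = I \/ J = unit_ideal.

Definition integral_closure J : set R :=
  [set x | exists n (c : nat -> R),
    [/\ (0 < n)%N, forall i, (1 <= i <= n)%N -> ideal_exp J i (c i) &
        x ^+ n + \sum_(1 <= i < n.+1) c i * x ^+ (n - i) = 0]].

Definition reduction J I : Prop := J `<=` I /\ I `<=` integral_closure J.

Definition complete_reduction n r (I : 'I_n -> ideal R) (a : 'M[R]_(n, r)) :=
  (forall i j, I i (a i j)) /\
  reduction (ideal_gen (range (fun j => \prod_(i < n) a i j))) (ideal_prod I).

Definition noetherian : Prop :=
  forall I, exists s : seq R, I = ideal_gen [set` s].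

Definition prime_chain n (P : 'I_n.+1 -> ideal R) : Prop :=
  (forall i, prime_ideal (P i)) /\
  (forall i j : 'I_n.+1, (i < j)%N -> P i `<` P j).

(* "the Krull dimension of R exists in nat and equals d" *)
Definition krull_dim_eq d : Prop :=
  (exists P, @prime_chain d P) /\
  (forall n P, @prime_chain n P -> (n <= d)%N).

End IdealTheory.

Record max_ideal (R : comNzRingType) := MaxIdeal {
  max_ideal_ideal :> ideal R;
  max_idealP : maximal_ideal max_ideal_ideal }.

(* "R is local with maximal ideal m" *)
Definition local_ring (R : comNzRingType) (m : max_ideal R) : Prop :=
  forall J : ideal R, maximal_ideal J -> J = m.

Section ResidueField.
Variables (R : comNzRingType) (m : max_ideal R).

Definition max_ideal_pred : {pred R} := fun x => x \in (m : set R).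

Lemma max_ideal_pred_closed : idealr_closed max_ideal_pred.
Proof.
split; rewrite /max_ideal_pred.
- by rewrite unfold_in inE; exact: ideal0.
- by rewrite unfold_in notin_setE; case: (max_idealP m).
- move=> a x y; rewrite !unfold_in !inE => hx hy.
  by apply: idealD => //; exact: idealMl.
Qed.

HB.instance Definition _ := isIdealr.Build R max_ideal_pred max_ideal_pred_closed.

Definition residue_field := {ideal_quot max_ideal_pred}.

HB.instance Definition _ := GRing.ComNzRing.copy residue_field {ideal_quot max_ideal_pred}.

Definition residue : R -> residue_field := \pi_residue_field%qT.

HB.instance Definition _ := GRing.RMorphism.on residue.

Lemma residue_eq0 x : residue x = 0 <-> m x.
Proof.
have <- : residue 0 = 0 by exact: rmorph0.
have -> : residue x = residue 0 <-> x - 0 \in max_ideal_pred.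
  by rewrite Quotient.idealrBE; split=> [/eqP|/eqP].
by rewrite subr0 unfold_in inE.
Qed.

Lemma residue_surj (q : residue_field) : exists x, residue x = q.
Proof. by exists (repr q); rewrite /residue reprK. Qed.

Lemma residue_inv_ex (q : residue_field) : exists r : residue_field,
  if q == 0 then r = 0 else r * q = 1.
Proof.
have [x <-] := residue_surj q.
have [x0|x0] := eqVneq (residue x) 0; first by exists 0.
have mx : ~ m x by move=> /residue_eq0 e; rewrite e eqxx in x0.
have hJ : is_ideal [set y | exists a z, m z /\ y = a * x + z].
  split=> [|y z [a [u [hu ->]]] [b [v [hv ->]]]|c y [a [u [hu ->]]]].
  - by exists 0, 0; split; [exact: ideal0|rewrite mul0r addr0].
  - by exists (a + b), (u + v); split; [exact: idealD|rewrite mulrDl addrACA].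
  - by exists (c * a), (c * u); split; [exact: idealMl|rewrite mulrDr mulrA].
have [_ /(_ (Ideal hJ))] := max_idealP m.
case=> [z hz|/(congr1 (fun J : ideal R => J x))/= e|/(congr1 (fun J : ideal R => J 1))/= e].
- by exists 0, z; rewrite mul0r add0r.
- case: mx; rewrite -e; exists 1, 0; split; first exact: ideal0.
  by rewrite mul1r addr0.
- have [a [z [hz e1]]] : exists a z, m z /\ 1 = a * x + z by rewrite e.
  exists (residue a).
  have <- : residue 1 = 1 by exact: rmorph1.
  have -> : residue 1 = residue a * residue x + residue z.
    by rewrite e1 -[LHS]/(\pi_residue_field%qT _) rmorphD rmorphM.
  by move/residue_eq0: hz => ->; rewrite addr0.
Qed.

Definition residue_inv (q : residue_field) : residue_field :=
  sval (cid (residue_inv_ex q)).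

Lemma residue_mulVf (q : residue_field) : q != 0 -> residue_inv q * q = 1.
Proof.
by rewrite /residue_inv; case: cid => /= r; case: ifPn.
Qed.

Lemma residue_inv0 : residue_inv 0 = 0.
Proof. by rewrite /residue_inv; case: cid => /= r; rewrite eqxx. Qed.

HB.instance Definition _ :=
  GRing.ComNzRing_isField.Build residue_field residue_mulVf residue_inv0.

End ResidueField.

(* The Rees ring, with the direct sum of the I^i realised as the subring
   of the p in R[t] whose coefficient of t^i lies in I^i. *)
Section ReesRing.
Variables (R : comNzRingType) (I : ideal R).

Definition rees_pred : {pred {poly R}} :=
  fun p => `[< forall i, ideal_exp I i p`_i >].

Lemma rees_pred_closed : subring_closed rees_pred.
Proof.
split=> [|p q /asboolP hp /asboolP hq|p q /asboolP hp /asboolP hq];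
  apply/asboolP => i.
- rewrite coef1; case: i => [|i]; [exact: Logic.I|exact: ideal0].
- by rewrite coefB; apply: idealD => //; exact: idealN.
- rewrite coefM; apply: ideal_sum => j _.
  have := ideal_expM (hp j) (hq (i - j)%N).
  by rewrite subnKC // -ltnS.
Qed.

HB.instance Definition _ :=
  GRing.isSubringClosed.Build {poly R} rees_pred rees_pred_closed.

Record rees := Rees { rees_poly : {poly R}; _ : rees_poly \in rees_pred }.

HB.instance Definition _ := [isSub for rees_poly].
HB.instance Definition _ := [Choice of rees by <:].
HB.instance Definition _ := [SubChoice_isSubComNzRing of rees by <:].

End ReesRing.

Section FiberRing.
Variables (R : comNzRingType) (m : max_ideal R) (I : ideal R).

(* The ideal of the Rees ring whose degree i component is m I^i. *)
Definition fiber_pred : {pred rees I} :=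
  fun p => `[< forall i, ideal_mul m (ideal_exp I i) (\val p)`_i >].

Lemma fiber_pred_closed : idealr_closed fiber_pred.
Proof.
split.
- by apply/asboolP => i; rewrite raddf0 coef0; exact: ideal0.
- apply/negP => /asboolP /(_ 0); rewrite rmorph1 coef1 /= => h.
  have [+ _] := max_idealP m; apply.
  by apply: (@ideal_mul_sub _ m (ideal_exp I 0) m _ _ h) => x y hx _; rewrite mulrC; exact: idealMl.
- move=> a p q /asboolP hp /asboolP hq; apply/asboolP => i.
  rewrite rmorphD rmorphM coefD; apply: idealD => //.
  rewrite mulrC coefM; apply: ideal_sum => j _.
  have := ideal_mulMr (hp j) (asboolW (valP a) (i - j)%N).
  apply: ideal_mulSr; apply: ideal_mul_sub => x y hx hy.
  by have := ideal_expM hx hy; rewrite subnKC // -ltnS.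
Qed.

HB.instance Definition _ := isIdealr.Build (rees I) fiber_pred fiber_pred_closed.

(* The direct sum of the I^i / m I^i *)
Definition fiber_ring := {ideal_quot fiber_pred}.

Definition analytic_spread_eq d : Prop := krull_dim_eq fiber_ring d.

End FiberRing.

Definition zariski_closed (k : fieldType) N (M : set 'rV[k]_N) : Prop :=
  exists S : set (mpoly.mpoly N k),
    M = [set v : 'rV[k]_N | forall p, S p -> mpoly.meval (fun i => v 0 i) p = 0].

Section AlmostAll.
Variables (R : comNzRingType) (m : max_ideal R).

Definition almost_all_vec N (A : set 'rV[R]_N) : Prop :=
  exists M : set 'rV[residue_field m]_N,
    [/\ zariski_closed M, M `<` setT &
        forall u, ~ M (map_mx (residue m) u) -> A u].

(* k^(n x d) is identified with k^(n * d) through [mxvec]. *)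
Definition almost_all_mx n d (A : set 'M[R]_(n, d)) : Prop :=
  exists M : set 'rV[residue_field m]_(n * d),
    [/\ zariski_closed M, M `<` setT &
        forall Z, ~ M (mxvec (map_mx (residue m) Z)) -> A Z].

End AlmostAll.

(* Main.v *)
Require Import Defs.
From mathcomp Require Import all_boot all_order all_algebra.
From mathcomp Require Import boolp classical_sets functions cardinality.
From mathcomp Require Import mpoly zify ring.

(* Write alpha_j, beta_j for the column products, let x = alpha_d be the last one
   and A the ideal generated by the others. Modulo m I^(l+1) + A I^l the powers
   I^(l+1) become finite-dimensional k-spaces V_l with x V_l = V_(l+1) for large l;
   their dimensions stabilise, so x eventually acts bijectively and each y in I acts
   on the stable space V by the operator y/x. These operators commute, and
   (alpha_1, .., alpha_(d-1), gamma) is a reduction of I as soon as gamma/x is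
   invertible on V (Nakayama and the determinant trick). For
   gamma = prod_i sum_h z_ih b_ih the determinant of gamma/x is a polynomial in z.
   It is not identically zero: as x is integral over the ideal of the beta_j, on every
   simple factor of V some beta_j/x is nonzero, hence invertible, and beta_j is the
   value of gamma at z_ih = delta_hj. *)

Set Implicit Arguments.
Unset Strict Implicit.
Unset Printing Implicit Defensive.

Import GRing.Theory.
Local Open Scope ring_scope.
Local Open Scope classical_set_scope.

(** * Products, powers and generators of ideals *)

Section Ideals.
Variable R : comNzRingType.
Implicit Types (I J K : ideal R).

Lemma mem_ideal_gen (S : set R) x : S x -> ideal_gen S x.
Proof. exact: sub_gen_smallest. Qed.

Lemma ideal_gen_sub (S : set R) K : S `<=` K -> ideal_gen S `<=` K.
Proof. exact: (smallest_sub (ideal_setP K)). Qed.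

Lemma mem_ideal_mul_gen d (c : 'I_d -> R) K x :
  ideal_mul (ideal_gen (range c)) K x <->
  exists2 y : 'I_d -> R, forall j, K (y j) & x = \sum_j c j * y j.
Proof.
split; last first.
  move=> [y Ky ->]; apply: ideal_sum => j _; apply: mem_ideal_mul => //.
  by apply: mem_ideal_gen; exists j.
have hH : is_ideal [set x | exists2 y : 'I_d -> R, forall j, K (y j) &
                               x = \sum_j c j * y j].
  split=> [|_ _ [y Ky ->] [z Kz ->]|a _ [y Ky ->]].
  - by exists (fun=> 0) => [j|]; [exact: ideal0|rewrite big1 // => j; rewrite mulr0].
  - exists (fun j => y j + z j) => [j|]; first exact: idealD.
    by rewrite -big_split; apply: eq_bigr => j _; rewrite mulrDr.
  - exists (fun j => a * y j) => [j|]; first exact: idealMl.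
    by rewrite mulr_sumr; apply: eq_bigr => j _; rewrite mulrCA.
apply: (@ideal_mul_sub _ _ _ (Ideal hH)) => u v uc Kv.
suff : ideal_gen (range c) `<=` colon_ideal K (Ideal hH) by move=> /(_ _ uc _ Kv).
apply: ideal_gen_sub => _ [j _ <-] y Ky /=.
exists (fun i => if i == j then y else 0) => [i|].
  by case: ifP => // _; exact: ideal0.
rewrite (bigD1 j) //= eqxx big1 ?addr0 // => i /negPf ->.
by rewrite mulr0.
Qed.

Lemma mem_ideal_gen_range d (c : 'I_d -> R) x :
  ideal_gen (range c) x <-> exists y : 'I_d -> R, x = \sum_j y j * c j.
Proof.
split=> [xc|[y ->]]; last first.
  by apply: ideal_sum => j _; apply: idealMl; apply: mem_ideal_gen; exists j.
have : ideal_mul (ideal_gen (range c)) (unit_ideal R) (x * 1) by exact: mem_ideal_mul.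
rewrite mulr1 mem_ideal_mul_gen => -[y _ ->].
by exists y; apply: eq_bigr => j _; rewrite mulrC.
Qed.

Lemma ideal_mulC I J x : ideal_mul I J x -> ideal_mul J I x.
Proof.
by apply: ideal_mul_sub => u v uI vJ; rewrite mulrC; exact: mem_ideal_mul.
Qed.

Lemma ideal_mulSl I J K : I `<=` J -> ideal_mul I K `<=` ideal_mul J K.
Proof. by move=> IJ; apply: ideal_mul_sub => x y /IJ; exact: mem_ideal_mul. Qed.

Lemma ideal_exp_sub I J m : I `<=` J -> ideal_exp I m `<=` ideal_exp J m.
Proof.
move=> IJ; elim: m => //= m IH.
by apply: (subset_trans (ideal_mulSl IJ)); exact: ideal_mulSr.
Qed.

Lemma mem_ideal_exp1 I x : I x -> ideal_exp I 1 x.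
Proof. by move=> Ix; rewrite -(mulr1 x); exact: mem_ideal_mul. Qed.

Lemma ideal_expX I x m : I x -> ideal_exp I m (x ^+ m).
Proof. by move=> Ix; elim: m => //= m IH; rewrite exprS; exact: mem_ideal_mul. Qed.

Lemma mem_ideal_prod n (I : 'I_n -> ideal R) (x : 'I_n -> R) :
  (forall i, I i (x i)) -> ideal_prod I (\prod_i x i).
Proof.
move=> Ix; rewrite /ideal_prod; elim/big_ind2: _ => // a A b B.
exact: mem_ideal_mul.
Qed.

Lemma noetherian_fg I : noetherian R ->
  exists q (g : 'I_q -> R), I = ideal_gen (range g).
Proof.
move=> /(_ I)[s ->]; exists (size s), (fun i => tnth (in_tuple s) i).
apply: ideal_eq; congr (ideal_set (ideal_gen _)); apply/seteqP; split=> [x|x [i _ <-]] /=.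
  by move=> /(tnthP (in_tuple s))[i ->]; exists i.
exact: mem_tnth.
Qed.

(** Cramer's rule: multiply by the adjugate of [B]. For [K] zero this is the determinant trick for
    integrality; other [K] serve Nakayama's lemma. *)
Lemma ideal_det_mul q (B : 'M[R]_q) (g : 'cV[R]_q) K :
  (forall i, K ((B *m g) i 0)) -> forall i, K (\det B * g i 0).
Proof.
move=> Bg i; have <- : ((\adj B *m (B *m g)) i 0) = \det B * g i 0.
  by rewrite mulmxA mul_adj_mx mul_scalar_mx mxE.
by rewrite mxE; apply: ideal_sum => j _; apply: idealMl.
Qed.

(** * Integral dependence and the inclusion of I^(s+1) in J I^s *)

Lemma integral_exp_mem I J x : J `<=` I -> I x -> integral_closure J x ->
  exists n, ideal_mul J (ideal_exp I n) (x ^+ n.+1).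
Proof.
move=> JI Ix [[|n] [c [// _ Jc /eqP]]]; rewrite addr_eq0 => /eqP xE; exists n; rewrite xE.
(* A coefficient in J^(i+1), hence in J I^i, times x^(n-i) gives an element of J I^n. *)
apply: idealN; rewrite big_nat; apply: ideal_sum => -[//|i] /andP[_ ilt].
have /= := Jc i.+1 ilt; rewrite subSS => /ideal_mulMr/(_ (ideal_expX (n - i) Ix)).
apply: ideal_mulSr; apply: ideal_mul_sub => u v /(ideal_exp_sub JI) uI vI.
by have := ideal_expM uI vI; rewrite subnKC.
Qed.

(** The induction strips one letter [j] off the words in the generators, passing from [K] to its
    colon by [g j]. *)
Lemma ideal_exp_gen_sub q (g : 'I_q -> R) N K :
  (forall f : seq 'I_q, size f = N -> K (\prod_(i <- f) g i)) ->
  ideal_exp (ideal_gen (range g)) N `<=` K.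
Proof.
elim: N K => [|N IH] K hK.
  have := hK [::] erefl; rewrite big_nil => K1 x _.
  by rewrite -(mulr1 x); exact: idealMl.
move=> /= x /mem_ideal_mul_gen[y hy ->]; apply: ideal_sum => j _.
suff /(_ _ (hy j) (g j) erefl) : ideal_exp (ideal_gen (range g)) N `<=`
  colon_ideal [set g j] K by rewrite mulrC.
apply: IH => f fN _ /= ->.
by have := hK (j :: f); rewrite big_cons /= fN mulrC; apply.
Qed.

Lemma ideal_prod_seq q (g : 'I_q -> R) I (f : seq 'I_q) (P : pred 'I_q) :
  (forall i, I (g i)) -> ideal_exp I (count P f) (\prod_(i <- f | P i) g i).
Proof.
move=> Ig; elim: f => [|i f IH]; first by rewrite big_nil.
rewrite big_cons /=; case: (P i) => //.
exact: mem_ideal_mul.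
Qed.

(* Pigeonhole: a long product of generators contains a high power of one of them. *)
Lemma reduction_exp I J : noetherian R -> reduction J I ->
  exists s, ideal_exp I s.+1 `<=` ideal_mul J (ideal_exp I s).
Proof.
move=> Rnoeth [JI IJ]; have [q [g gE]] := noetherian_fg I Rnoeth.
have Ig i : I (g i) by rewrite gE; apply: mem_ideal_gen; exists i.
have /choice[e he] i := integral_exp_mem JI (Ig i) (IJ _ (Ig i)).
(* By choice of [e], [g i ^+ (e i).+1] lies in J I^(e i). In a word of length s+1 some letter [i]
   occurs more than [e i] times. *)
pose s := (\sum_i e i)%N; exists s; rewrite {1}gE.
apply: ideal_exp_gen_sub => f fs.
have [i hi] : exists i, (e i < count_mem i f)%N.
  apply: contrapT => h; have : (size f <= s)%N; last by rewrite fs ltnn.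
  have -> : size f = (\sum_i count_mem i f)%N.
    by rewrite -sum1_size (partition_big id xpredT) //=; apply: eq_bigr => i _; rewrite -sum1_count.
  by apply: leq_sum => i _; rewrite leqNgt; apply/negP => hi; apply: h; exists i.
rewrite (bigID (pred1 i)) /=.
have -> : \prod_(l <- f | l == i) g l = g i ^+ (e i).+1 * g i ^+ (count_mem i f - (e i).+1).
  rewrite -exprD subnKC // (eq_bigr (fun=> g i)) => [|l /eqP->//].
  by rewrite big_const_seq iter_mulr_1.
have := ideal_mulMr (he i) (ideal_expM (ideal_expX (count_mem i f - (e i).+1) (Ig i))
  (ideal_prod_seq f (predC1 i) Ig)).
rewrite -mulrA; apply: ideal_mulSr; apply: ideal_mul_sub => u v uI vI.
have := ideal_expM uI vI.
have <- : (e i + (count_mem i f - (e i).+1 + count (predC1 i) f))%N = s => //.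
have : (count_mem i f + count (predC1 i) f)%N = s.+1.
  by rewrite -fs -(count_predC (pred1 i) f).
by move: hi; set a := count_mem i f; set b := count (predC1 i) f; lia.
Qed.

Lemma reduction_exp_stable I J s t :
  ideal_exp I s.+1 `<=` ideal_mul J (ideal_exp I s) -> (s <= t)%N ->
  ideal_exp I t.+1 `<=` ideal_mul J (ideal_exp I t).
Proof.
move=> h /subnK <-; elim: (t - s)%N => [|u IH] //; rewrite addSn.
apply: ideal_mul_sub => x y Ix /IH Iy.
by rewrite mulrC; apply: ideal_mulSr (ideal_mulMr Iy Ix) => z /ideal_mulC.
Qed.

(* [p] is homogeneous of degree [n] when ['X] has degree 1 and the elements
   of [J^i] have degree [i]. *)
Definition homog_poly J n (p : {poly R}) : Prop :=
  forall i, ideal_exp J (n - i) p`_i /\ ((n < i)%N -> p`_i = 0).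

Lemma homog_polyD J n p p' :
  homog_poly J n p -> homog_poly J n p' -> homog_poly J n (p + p').
Proof.
move=> hp hp' i; have [pJ p0] := hp i; have [pJ' p0'] := hp' i.
by rewrite coefD; split=> [|ni]; [exact: idealD|rewrite p0 // p0' // addr0].
Qed.

Lemma homog_poly0 J n : homog_poly J n 0.
Proof. by move=> i; rewrite coef0; split=> //; exact: ideal0. Qed.

Lemma homog_polyM J n n' p p' :
  homog_poly J n p -> homog_poly J n' p' -> homog_poly J (n + n') (p * p').
Proof.
move=> hp hp' i; rewrite coefM; split=> [|ni].
  apply: ideal_sum => -[j /= ji] _; have [pJ p0] := hp j.
  have [pJ' p0'] := hp' (i - j)%N.
  have [nj|jn] := ltnP n j; first by rewrite p0 // mul0r; exact: ideal0.
  have [nj'|jn'] := ltnP n' (i - j); first by rewrite p0' // mulr0; exact: ideal0.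
  by have := ideal_expM pJ pJ'; congr (ideal_exp J _ _); lia.
rewrite big1 // => -[j /= ji] _.
have [nj|jn] := ltnP n j; first by rewrite (hp j).2 // mul0r.
by rewrite (hp' _).2 ?mulr0 //; lia.
Qed.

Lemma homog_polyC J n c : ideal_exp J n c -> homog_poly J n c%:P.
Proof.
by move=> Jc [|i]; rewrite coefC ?subn0 //; split=> //; exact: ideal0.
Qed.

Lemma homog_polyX J : homog_poly J 1 'X.
Proof.
by move=> [|[|i]]; rewrite coefX; split=> //; try exact: ideal0.
Qed.

(** The entries of the characteristic matrix have degree 1, so every term of its determinant has
    degree [q]. Hence the coefficient of X^(q-i) lies in J^i, as an integral equation over [J]
    demands. *)
Lemma homog_char_poly J q (A : 'M[R]_q) :
  (forall i j, J (A i j)) -> homog_poly J q (char_poly A).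
Proof.
move=> JA; rewrite /char_poly /determinant; elim/big_ind: _ => [|p p'|s _].
- exact: homog_poly0.
- exact: homog_polyD.
have -> : (-1) ^+ perm.odd_perm s = ((-1) ^+ perm.odd_perm s)%:P :> {poly R}.
  by rewrite rmorphXn rmorphN1.
have hM i j : homog_poly J 1 (char_poly_mx A i j).
  rewrite !mxE -polyCN; apply: homog_polyD.
    by case: eqP => _; [exact: homog_polyX|exact: homog_poly0].
  by apply: homog_polyC; apply: mem_ideal_exp1; apply: idealN.
rewrite -[q in homog_poly J q]add0n; apply: homog_polyM; first exact: homog_polyC.
rewrite -big_enum -{1}(size_enum_ord q) /=; elim: (enum _) => [|i r IH].
  by rewrite big_nil; exact: homog_polyC.
by rewrite big_cons; apply: (homog_polyM (hM _ _)).
Qed.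

Lemma horner_char_poly q (A : 'M[R]_q) x : (char_poly A).[x] = \det (x%:M - A).
Proof.
rewrite -/(horner_eval x _) /char_poly -det_map_mx; congr (\det _).
apply/matrixP => i j; rewrite !mxE rmorphB /= /horner_eval hornerC; congr (_ - _).
by rewrite hornerMn hornerX.
Qed.

Lemma is_ideal_set0 : is_ideal [set 0 : R].
Proof. by split=> // [x y -> ->|a x ->] /=; rewrite ?addr0 ?mulr0. Qed.

(** Determinant trick: [x] acts on generators of I^s by a matrix [A] over [J], so [\det (x%:M - A)]
    kills I^s, in particular x^s. Thus [x] is a root of the characteristic polynomial times a power
    of X. *)
Lemma integral_of_exp_sub I J s x : noetherian R -> I x ->
  ideal_exp I s.+1 `<=` ideal_mul J (ideal_exp I s) -> integral_closure J x.
Proof.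
move=> Rnoeth Ix IsJ; have [q [g gE]] := noetherian_fg (ideal_exp I s) Rnoeth.
have Ig i : ideal_exp I s (g i) by rewrite gE; apply: mem_ideal_gen; exists i.
have /choice[y hy] i : exists y : 'I_q -> R,
    (forall j, J (y j)) /\ x * g i = \sum_j g j * y j.
  have := ideal_mulC (IsJ _ (mem_ideal_mul Ix (Ig i))).
  by rewrite gE mem_ideal_mul_gen => -[y Jy ->]; exists y.
pose A : 'M[R]_q := \matrix_(i, j) y i j.
have Ag i : \det (x%:M - A) * g i = 0.
  have := @ideal_det_mul q (x%:M - A) (\col_i g i) (Ideal is_ideal_set0) _ i.
  rewrite mxE; apply => l /=; rewrite mulmxBl mul_scalar_mx !mxE (hy l).2.
  rewrite -sumrB big1 // => j _; rewrite !mxE mulrC subrr //.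
have Axs : (char_poly A).[x] * x ^+ s = 0.
  rewrite horner_char_poly; have := ideal_expX s Ix.
  rewrite gE mem_ideal_gen_range => -[z ->]; rewrite mulr_sumr big1 // => i _.
  by rewrite mulrCA Ag mulr0.
have JA : homog_poly J q (char_poly A).
  by apply: homog_char_poly => i j; rewrite mxE; exact: (hy i).1.
have szA := size_char_poly A.
have cpq : (char_poly A)`_q = 1.
  by have /monicP := char_poly_monic A; rewrite /lead_coef szA.
(* Coefficients, from the top degree down, of the characteristic polynomial times X^(s+1); the
   lowest s+1 vanish. The exponent s+1 instead of s keeps the degree positive when q = s = 0. *)
pose c i := if (i <= q)%N then (char_poly A)`_(q - i) else 0.
exists (q + s.+1)%N, c; split; first by rewrite addnS.
  move=> i _; rewrite /c; case: leqP => iq; last exact: ideal0.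
  by have [+ _] := JA (q - i)%N; rewrite subKn.
transitivity (\sum_(0 <= i < (q + s.+1).+1) c i * x ^+ (q + s.+1 - i)).
  by rewrite [RHS]big_ltn // (_ : c 0%N = 1) ?subn0 ?mul1r // /c leq0n subn0.
rewrite (@big_cat_nat _ _ _ q.+1) //=; last by rewrite ltnS leq_addr.
rewrite [X in _ + X]big_nat [X in _ + X]big1 ?addr0; last first.
  by move=> i /andP[qi _]; rewrite /c leqNgt qi mul0r.
transitivity ((char_poly A).[x] * x ^+ s.+1); last by rewrite exprSr mulrA Axs mul0r.
rewrite horner_coef szA mulr_suml big_mkord (reindex_inj rev_ord_inj).
apply: eq_bigr => -[i /= iq] _; rewrite /c /= subSS leq_subr subKn //.
by rewrite -mulrA -exprD; congr (_ * _ ^+ _); lia.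
Qed.

End Ideals.

(** * Local rings: units and Nakayama's lemma *)

Section LocalRing.
Variables (R : comNzRingType) (m : max_ideal R).
Hypothesis Rloc : local_ring m.

(** By Zorn's lemma a non-unit lies in an ideal maximal among the proper ones, which locality
    identifies with [m]. *)
Lemma local_inv x : ~ m x -> exists y, y * x = 1.
Proof.
move=> mx; apply: contrapT => xinv.
pose P (S : set R) := S = set0 \/ [/\ is_ideal S, S x & ~ S 1].
have hx : P [set z | exists a, z = a * x].
  right; split=> [||[y y1]]; last by apply: xinv; exists y.
    split=> [|_ _ [a ->] [b ->]|c _ [a ->]].
    - by exists 0; rewrite mul0r.
    - by exists (a + b); rewrite mulrDl.
    - by exists (c * a); rewrite mulrA.
  by exists 1; rewrite mul1r.
have [|S [[S0|[Sid Sx S1]] Smax]] := @Zorn_bigcup _ P.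
- move=> F FP Ftot; have [[S0 FS0 [z0 S0z0]]|FE] :=
    pselect (exists2 S, F S & exists z, S z); last first.
    by left; apply/seteqP; split=> // z [S FS Sz]; case: FE; exists S => //; exists z.
  have Fid S z : F S -> S z -> [/\ is_ideal S, S x & ~ S 1].
    by move=> /FP[->|].
  right; split; last by move=> [S FS S1]; have [_ _] := Fid _ _ FS S1.
    split=> [|y z [S FS Sy] [T FT Tz]|a z [S FS Sz]].
    + by exists S0 => //; have [[]] := Fid _ _ FS0 S0z0.
    + have [[_ SD _] _ _] := Fid _ _ FS Sy; have [[_ TD _] _ _] := Fid _ _ FT Tz.
      have [ST|TS] := Ftot _ _ FS FT.
        by exists T => //; apply: TD => //; exact: ST.
      by exists S => //; apply: SD => //; exact: TS.
    + by exists S => //; have [[_ _ SM] _ _] := Fid _ _ FS Sz; exact: SM.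
  by exists S0 => //; have [] := Fid _ _ FS0 S0z0.
- apply: (Smax _ _ hx); rewrite S0; split=> // /(_ x); apply.
  by exists 1; rewrite mul1r.
- suff : Ideal Sid = m by move=> /(congr1 (fun J : ideal R => J x)) /= e; apply: mx; rewrite -e.
  apply: Rloc; split=> // J SJ; have [J1|J1] := pselect (J 1).
    right; apply: ideal_eq; apply/seteqP; split=> // z _.
    by rewrite -(mulr1 z); exact: idealMl.
  left; apply: ideal_eq; apply/seteqP; split=> //; apply: contrapT => nJS.
  apply: (Smax J) => //; right; split=> //; first exact: ideal_setP.
  exact: SJ.
Qed.

(** Generators [g] of [M] satisfy (1 - Y) g in [N] with Y over [m]. The determinant of 1 - Y is 1
    modulo [m], hence a unit, and [ideal_det_mul] puts every [g i] into [N]. *)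
Lemma local_nakayama (M N : ideal R) : noetherian R ->
  (forall z, M z -> exists2 u, N u & ideal_mul m M (z - u)) -> M `<=` N.
Proof.
move=> Rnoeth MN; have [q [g gE]] := noetherian_fg M Rnoeth.
have Mg i : M (g i) by rewrite gE; apply: mem_ideal_gen; exists i.
have /choice[y hy] i : exists y : 'I_q -> R,
    (forall j, m (y j)) /\ N (g i - \sum_j g j * y j).
  have [u Nu /ideal_mulC] := MN _ (Mg i).
  by rewrite gE mem_ideal_mul_gen => -[y my yE]; exists y; rewrite -yE subKr.
pose B : 'M[R]_q := 1%:M - \matrix_(i, j) y i j.
have Bg i : N (\det B * g i).
  have := @ideal_det_mul R q B (\col_i g i) N _ i.
  rewrite mxE; apply => l; rewrite mulmxBl mul1mx !mxE.
  have := (hy l).2; congr (N (_ - _)); apply: eq_bigr => j _.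
  by rewrite !mxE mulrC.
have [|b bB] := @local_inv (\det B).
  move=> /residue_eq0; rewrite -det_map_mx map_mxB map_mx1.
  rewrite (_ : map_mx _ (\matrix_(i, j) _) = 0) ?subr0 ?det1; last first.
    apply/matrixP => i j; rewrite !mxE; apply/residue_eq0; exact: (hy i).1.
  by move/eqP; rewrite oner_eq0.
rewrite gE; apply: ideal_gen_sub => _ [i _ <-].
by rewrite -(mul1r (g i)) -bB -mulrA; exact: idealMl.
Qed.

End LocalRing.

(** * Generic points and generically invertible matrices *)

Section GenericPoints.
Variables (k : fieldType) (N : nat).
Implicit Types (A B : ('I_N -> k) -> Prop) (p : {mpoly k[N]}).

(** A nonzero value is demanded instead of [p != 0], so that the zero locus of [p] is proper over
    any field. *)
Definition holds_generically A : Prop := exists p : {mpoly k[N]},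
  (exists v, p.@[v] != 0) /\ forall v, p.@[v] != 0 -> A v.

Lemma holds_genericallyT A : (forall v, A v) -> holds_generically A.
Proof.
move=> hA; exists 1; split=> [|v _]; last exact: hA.
by exists (fun=> 0); rewrite meval1 oner_eq0.
Qed.

Lemma holds_generically_sub A B :
  (forall v, A v -> B v) -> holds_generically A -> holds_generically B.
Proof. by move=> AB [p [hp pA]]; exists p; split=> // v /pA /AB. Qed.

(** The restriction of [p] to the line that meets [u] at parameter 0 and [v] at parameter 1. *)
Definition line_poly p (u v : 'I_N -> k) : {poly k} :=
  \sum_(m <- msupp p) p@_m *: \prod_i ((u i)%:P + (v i - u i) *: 'X) ^+ m i.

Lemma horner_line_poly p u v t :
  (line_poly p u v).[t] = p.@[fun i => u i + t * (v i - u i)].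
Proof.
rewrite /line_poly horner_sum mevalE; apply: eq_bigr => m _.
rewrite hornerZ horner_prod; congr (_ * _); apply: eq_bigr => i _.
by rewrite !hornerE mulrC.
Qed.

Lemma infinite_poly_nonroot (q : {poly k}) :
  infinite_set [set: k] -> q != 0 -> exists t, q.[t] != 0.
Proof.
move=> kinf q0; have [B _ hB] := infinite_set_fset (size q) kinf.
apply: contrapT => h.
have /(max_poly_roots q0)/(_ (finmap.fset_uniq B)) : all (root q) (finmap.enum_fset B).
  by apply/allP => t _; apply/rootP/eqP/negPn/negP => ht; apply: h; exists t.
by rewrite ltnNge hB.
Qed.

(* Two nonempty principal open sets meet: restrict both polynomials to the line
   through a point of each. *)
Lemma holds_genericallyI A B : infinite_set [set: k] ->
  holds_generically A -> holds_generically B ->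
  holds_generically (fun v => A v /\ B v).
Proof.
move=> kinf [p [[u pu] pA]] [q [[v qv] qB]].
have lp : line_poly p u v != 0.
  apply: contraNneq pu => e; apply/eqP.
  rewrite -(horner0 0) -e horner_line_poly; apply: meval_eq => i.
  by rewrite mul0r addr0.
have lq : line_poly q u v != 0.
  apply: contraNneq qv => e; apply/eqP.
  rewrite -(horner0 1) -e horner_line_poly; apply: meval_eq => i.
  by rewrite mul1r addrC subrK.
have [t] := infinite_poly_nonroot kinf (mulf_neq0 lp lq).
rewrite hornerM !horner_line_poly => ht.
exists (p * q); split; first by exists (fun i => u i + t * (v i - u i)); rewrite mevalM.
by move=> w; rewrite mevalM mulf_eq0 negb_or => /andP[/pA ? /qB].
Qed.

Lemma holds_generically_unitmx r (F : ('I_N -> k) -> 'M[k]_r)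
    (P : 'M[{mpoly k[N]}]_r) u :
  (forall v, F v = map_mx (meval v) P) -> F u \in unitmx ->
  holds_generically (fun v => F v \in unitmx).
Proof.
move=> FP Fu; exists (\det P).
have dE v : (\det P).@[v] = \det (F v) by rewrite FP det_map_mx.
split; first by exists u; rewrite dE -unitfE -unitmxE.
by move=> v; rewrite dE -unitfE -unitmxE.
Qed.

Variables (W : finType) (d : nat) (q : W -> {mpoly k[N]}) (w : 'I_d -> W).
Hypothesis kinf : infinite_set [set: k].
Hypothesis qw : forall j, exists v, forall w', (q w').@[v] = (w' == w j)%:R.

(** By [qw], each [T (w j)] is among the values of [ev T]. *)
Let ev r (T : W -> 'M[k]_r) v := \sum_w' (q w').@[v] *: T w'.

(* If some [T (w j)] is neither zero nor invertible, its kernel is stable under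
   all the matrices, and the claim holds on the kernel and on the quotient by it. *)
Lemma generic_combination_unitmx r (T : W -> 'M[k]_r) (C : 'I_d -> 'M[k]_r) :
  (forall j w', T (w j) *m T w' = T w' *m T (w j)) ->
  (forall j l, T (w j) *m C l = C l *m T (w j)) ->
  \sum_j T (w j) *m C j = 1%:M ->
  holds_generically (fun v => ev T v \in unitmx).
Proof.
have [s] := ubnP r; elim: s r T C => // s IH r T C rs TT TC T1.
have [[j Tj]|nTu] := pselect (exists j, T (w j) \in unitmx).
  have [u hu] := qw j.
  apply: (@holds_generically_unitmx r (ev T)
            (\sum_w' q w' *: map_mx (mpolyC N (R:=k)) (T w')) u).
    move=> v; apply/matrixP => i l; rewrite !mxE !summxE raddf_sum /=.
    by apply: eq_bigr => w' _; rewrite !mxE mevalM mevalC.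
  rewrite /ev (bigD1 (w j)) //= hu eqxx scale1r big1 ?addr0 // => w' /negPf nw.
  by rewrite hu nw scale0r.
have [[j Tj]|nT0] := pselect (exists j, T (w j) != 0); last first.
  (* All [T (w j)] vanish, so the relation forces 1 = 0 and every matrix is invertible. *)
  apply: holds_genericallyT => v.
  have m10 : 1%:M = 0 :> 'M[k]_r.
    rewrite -T1 big1 // => j _; case: (eqVneq (T (w j)) 0) => [->|h].
      by rewrite mul0mx.
    by case: nT0; exists j.
  by rewrite -[ev T v]mulmx1 m10 mulmx0 -m10 unitmx1.
have rK : (0 < \rank (kermx (T (w j))))%N.
  rewrite lt0n mxrank_eq0 kermx_eq0 row_free_unit.
  by apply/negP => h; apply: nTu; exists j.
have rT : (0 < \rank (T (w j)))%N by rewrite lt0n mxrank_eq0.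
set T0 := T (w j) in rK rT *.
pose comm S := T0 *m S = S *m T0.
(* Vectors are rows. The rows of [X] are a basis of the kernel of [T0], and [u *m Y] vanishes
   exactly when [u *m T0] does, so [Y] presents the quotient by that kernel. *)
pose X := row_base (kermx T0); pose Y := col_base T0.
have [Xi XXi] : exists Xi, X *m Xi = 1%:M.
  by exists (pinvmx X); rewrite mulmxVp // row_base_free.
have [Yi YiY] : exists Yi, Yi *m Y = 1%:M.
  by exists (pinvmx Y); rewrite mulVpmx // col_base_full.
(* For [S] commuting with [T0], these are the matrices induced on the kernel and on the quotient. *)
pose rstr S := X *m S *m Xi; pose quo S := Yi *m S *m Y.
have XT : X *m T0 = 0 by apply/sub_kermxP; rewrite eq_row_base.
have YE l (u : 'M_(l, r)) : (u *m Y == 0) = (u *m T0 == 0).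
  rewrite -[T0 in RHS]mulmx_base mulmxA -/Y.
  by rewrite -{1}(mul0mx _ (row_base T0)) (inj_eq (row_free_inj (row_base_free T0))).
have rstrX S : comm S -> rstr S *m X = X *m S.
  move=> cS; have /submxP[Z ZE] : (X *m S <= X)%MS.
    by rewrite !eq_row_base; apply/sub_kermxP; rewrite -mulmxA -cS mulmxA XT mul0mx.
  by rewrite /rstr ZE -(mulmxA Z) XXi mulmx1.
have quoY S : comm S -> Y *m quo S = S *m Y.
  move=> cS; have D0 : (Y *m Yi - 1%:M) *m T0 = 0.
    by apply/eqP; rewrite -YE mulmxBl mul1mx -(mulmxA Y) YiY mulmx1 subrr.
  have : (Y *m Yi - 1%:M) *m S *m Y == 0.
    by rewrite YE -(mulmxA _ S) -cS (mulmxA _ T0) D0 mul0mx.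
  by rewrite mulmxBl mul1mx mulmxBl subr_eq0 => /eqP <-; rewrite /quo !mulmxA.
have rstrM S S' : comm S -> rstr (S *m S') = rstr S *m rstr S'.
  move=> cS; have <- : rstr S *m X *m (S' *m Xi) = rstr S *m rstr S'.
    by rewrite /rstr !mulmxA.
  by rewrite rstrX // /rstr !mulmxA.
have quoM S S' : comm S' -> quo (S *m S') = quo S *m quo S'.
  move=> cS; have <- : Yi *m S *m (Y *m quo S') = quo S *m quo S'.
    by rewrite /quo !mulmxA.
  by rewrite quoY // /quo !mulmxA.
have rstr_sum (J : finType) (F : J -> 'M_r) : rstr (\sum_i F i) = \sum_i rstr (F i).
  by rewrite /rstr mulmx_sumr mulmx_suml.
have quo_sum (J : finType) (F : J -> 'M_r) : quo (\sum_i F i) = \sum_i quo (F i).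
  by rewrite /quo mulmx_sumr mulmx_suml.
have rstr1 : rstr 1%:M = 1%:M by rewrite /rstr mulmx1.
have quo1 : quo 1%:M = 1%:M by rewrite /quo mulmx1.
have cT w' : comm (T w') by exact: TT.
have cC l : comm (C l) by exact: TC.
have rkE := mxrank_ker T0.
have rTr : (\rank T0 <= r)%N by exact: rank_leq_row.
have IHK : holds_generically (fun v => ev (fun w' => rstr (T w')) v \in unitmx).
  apply: (IH _ _ (fun l => rstr (C l))) => [|i w'|i l|].
  - by move: rs rT rTr; rewrite rkE; lia.
  - by rewrite -!rstrM // TT.
  - by rewrite -!rstrM // TC.
  - by rewrite -rstr1 -T1 rstr_sum; apply: eq_bigr => i _; rewrite rstrM.
have IHQ : holds_generically (fun v => ev (fun w' => quo (T w')) v \in unitmx).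
  apply: (IH _ _ (fun l => quo (C l))) => [|i w'|i l|].
  - by move: rs rK; rewrite rkE; lia.
  - by rewrite -!quoM // TT.
  - by rewrite -!quoM // TC.
  - by rewrite -quo1 -T1 quo_sum; apply: eq_bigr => i _; rewrite quoM.
apply: holds_generically_sub (holds_genericallyI kinf IHK IHQ) => v [].
have rstr_ev : ev (fun w' => rstr (T w')) v = rstr (ev T v).
  by rewrite rstr_sum; apply: eq_bigr => w' _; rewrite /rstr scalemxAl scalemxAr.
have quo_ev : ev (fun w' => quo (T w')) v = quo (ev T v).
  by rewrite quo_sum; apply: eq_bigr => w' _; rewrite /quo scalemxAl scalemxAr.
have cev : comm (ev T v).
  rewrite /comm /ev mulmx_sumr mulmx_suml; apply: eq_bigr => w' _.
  by rewrite -scalemxAr cT scalemxAl.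
rewrite rstr_ev quo_ev -!row_free_unit => frK frQ.
(* A row killed by [ev T v] is zero in the quotient, so it lies in the kernel of [T0], where the
   restriction is injective. *)
rewrite -kermx_eq0; apply/eqP/row_matrixP => i; rewrite row0.
set u := row i _.
have u0 : u *m ev T v = 0 by rewrite -row_mul mulmx_ker row0.
have /sub_kermxP uK : u *m T0 = 0.
  apply/eqP; rewrite -YE -(inj_eq (row_free_inj frQ)) mul0mx -mulmxA quoY //.
  by rewrite mulmxA u0 mul0mx.
have /submxP[u' uE] : (u <= X)%MS by rewrite eq_row_base.
rewrite uE; apply/eqP; rewrite -(mul0mx _ X) (inj_eq (row_free_inj (row_base_free _))).
rewrite -(inj_eq (row_free_inj frK)) mul0mx.
rewrite -(inj_eq (row_free_inj (row_base_free (kermx T0)))) mul0mx.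
by rewrite -mulmxA rstrX // mulmxA -uE u0.
Qed.

End GenericPoints.

(** * The stable quotients and the operators on them *)

(* Multiplication by powers of [x] identifies the minimal generators of the
   quotients [E l / N l], [l >= j], with one another; [y] in [S s] then acts by
   the matrix of [x^-s y]. *)
Section StableAction.
Variables (R : comNzRingType) (m : max_ideal R) (S E N : nat -> ideal R).
Hypothesis Rloc : local_ring m.
Hypothesis SE : forall s j y z, S s y -> E j z -> E (s + j)%N (y * z).
Hypothesis SN : forall s j y z, S s y -> N j z -> N (s + j)%N (y * z).
Hypothesis mEN : forall j y z, m y -> E j z -> N j (y * z).
Hypothesis E_fg : forall j, exists q (g : 'I_q -> R), E j = ideal_gen (range g).
Variables (x : R) (j0 : nat).
Hypothesis Sx : forall s, S s (x ^+ s).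
Hypothesis E_step : forall j, (j0 <= j)%N -> forall z, E j.+1 z ->
  exists2 y, E j y & N j.+1 (z - x * y).

Definition spans j r (e : 'cV[R]_r) : Prop := (forall i, E j (e i 0)) /\
  forall z, E j z -> exists c : 'rV[R]_r, N j (z - (c *m e) 0 0).

Lemma spans_step j r (e : 'cV[R]_r) : (j0 <= j)%N ->
  spans j e -> spans j.+1 (x *: e).
Proof.
move=> j0j [Ee he]; split=> [i|z Ez].
  by rewrite mxE -add1n; exact: SE (Sx 1) (Ee i).
have [y Ey Nz] := E_step j0j Ez; have [c Nc] := he _ Ey; exists c.
rewrite -scalemxAr mxE; have -> : z - x * (c *m e) 0 0 =
  z - x * y + x * (y - (c *m e) 0 0) by rewrite mulrBr addrA subrK.
apply: idealD => //; rewrite -add1n; exact: SN (Sx 1) Nc.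
Qed.

Lemma spans_steps j r (e : 'cV[R]_r) s : (j0 <= j)%N ->
  spans j e -> spans (s + j) (x ^+ s *: e).
Proof.
move=> j0j ej; elim: s => [|s IH]; first by rewrite expr0 scale1r.
by rewrite exprS -scalerA; apply: spans_step => //; rewrite (leq_trans j0j) ?leq_addl.
Qed.

(** A relation modulo [N j] whose coefficient at [i] is a unit expresses that generator through the
    others. *)
Lemma spans_drop j r (e : 'cV[R]_r.+1) (c : 'rV[R]_r.+1) i :
  spans j e -> N j ((c *m e) 0 0) -> ~ m (c 0 i) -> exists e' : 'cV[R]_r, spans j e'.
Proof.
move=> [Ee he] Nc /(local_inv Rloc)[b bc].
exists (\col_l e (lift i l) 0); split=> [l|z /he[f Nf]]; first by rewrite mxE.
exists (\row_l (f 0 (lift i l) - f 0 i * b * c 0 (lift i l))).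
have -> : z - (\row_l (f 0 (lift i l) - f 0 i * b * c 0 (lift i l)) *m
    \col_l e (lift i l) 0) 0 0 =
  z - (f *m e) 0 0 + f 0 i * b * (c *m e) 0 0.
  rewrite -addrA; congr (_ + _); rewrite !mxE (bigD1_ord i) //= [in X in _ + _ * X](bigD1_ord i) //=.
  rewrite mulrDr mulrA -(mulrA (f 0 i)) bc mulr1 opprD addrACA addNr add0r.
  rewrite mulr_sumr -!sumrN -big_split; apply: eq_bigr => l _.
  by rewrite !mxE mulrBl opprB addrC mulrA.
by apply: idealD => //; exact: idealMl.
Qed.

Lemma minimal_generators : exists j r (e : 'cV[R]_r), (j0 <= j)%N /\ forall s,
  [/\ forall i, E (s + j) (x ^+ s * e i 0),
      forall z, E (s + j) z -> exists c : 'rV[R]_r, N (s + j) (z - x ^+ s * (c *m e) 0 0)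
    & forall c : 'rV[R]_r, N (s + j) (x ^+ s * (c *m e) 0 0) -> forall i, m (c 0 i)].
Proof.
pose Q r := `[< exists2 j, (j0 <= j)%N & exists e : 'cV[R]_r, spans j e >].
have exQ : exists r, Q r.
  have [q [g gE]] := E_fg j0; exists q; apply/asboolP; exists j0 => //.
  exists (\col_i g i); split=> [i|z].
    by rewrite mxE gE; apply: mem_ideal_gen; exists i.
  rewrite {1}gE mem_ideal_gen_range => -[y ->]; exists (\row_i y i).
  rewrite mxE -sumrB big1; first exact: ideal0.
  by move=> i _; rewrite !mxE subrr.
case: (ex_minnP exQ) => r /asboolP[j j0j [e ej]] rmin; exists j, r, e; split=> // s.
have [Ese spe] := spans_steps s j0j ej; split=> [i|z /spe[c]|c].
- by have := Ese i; rewrite mxE.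
- by rewrite -scalemxAr mxE; exists c.
- have -> : x ^+ s * (c *m e) 0 0 = (c *m (x ^+ s *: e)) 0 0 by rewrite -scalemxAr [RHS]mxE.
  case: r e ej rmin c Ese spe => [|r] e ej rmin c Ese spe Nc i; first by case: i.
  apply: contrapT => mi; have [e' e'P] := spans_drop (conj Ese spe) Nc mi.
  have : (r.+1 <= r)%N; last by rewrite ltnn.
  apply: rmin; apply/asboolP; exists (s + j)%N; last by exists e'.
  by rewrite (leq_trans j0j) ?leq_addl.
Qed.

Section Represent.
Variables (j r : nat) (e : 'cV[R]_r).
Hypothesis e_gen : forall s,
  [/\ forall i, E (s + j) (x ^+ s * e i 0),
      forall z, E (s + j) z -> exists c : 'rV[R]_r, N (s + j) (z - x ^+ s * (c *m e) 0 0)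
    & forall c : 'rV[R]_r, N (s + j) (x ^+ s * (c *m e) 0 0) -> forall i, m (c 0 i)].

Definition represents s y (t : 'M[R]_r) : Prop :=
  forall i, N (s + j) (y * e i 0 - x ^+ s * (t *m e) i 0).

Lemma E_gen i : E j (e i 0).
Proof. by have [/(_ i)] := e_gen 0; rewrite mul1r. Qed.

Lemma represents_ex s y : S s y -> exists t, represents s y t.
Proof.
move=> Sy; have /choice[c hc] i : exists c : 'rV[R]_r,
    N (s + j) (y * e i 0 - x ^+ s * (c *m e) 0 0).
  by have [_ + _] := e_gen s; apply; apply: SE => //; exact: E_gen.
exists (\matrix_(i, l) c i 0 l) => i; have := hc i; rewrite !mxE.
by congr (N _ (_ - _ * _)); apply: eq_bigr => l _; rewrite mxE.
Qed.

(** The rows of the difference are relations among the multiples of [e] by x^s, so their entries lie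
    in [m]. Identities in [R] thereby become identities of matrices over the residue field. *)
Lemma represents_uniq s y t t' : represents s y t -> represents s y t' ->
  map_mx (residue m) t = map_mx (residue m) t'.
Proof.
move=> ht ht'; apply/matrixP => i l; rewrite !mxE; apply/eqP.
rewrite -subr_eq0 -rmorphB; apply/eqP/residue_eq0.
have h : N (s + j) (x ^+ s * (row i (t - t') *m e) 0 0).
  rewrite -row_mul mxE mulmxBl [X in _ * X]mxE [X in _ + X]mxE.
  have := idealD (ht' i) (idealN (ht i)); congr (N _ _).
  by ring.
by have [_ _ /(_ _ h l)] := e_gen s; rewrite !mxE.
Qed.

Lemma represents_mul s s' y y' t t' : S s y -> S s' y' ->
  represents s y t -> represents s' y' t' -> represents (s + s') (y * y') (t *m t').
Proof.
move=> Sy Sy' ht ht' i.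
have -> : y * y' * e i 0 - x ^+ (s + s') * (t *m t' *m e) i 0 =
    y' * (y * e i 0 - x ^+ s * (t *m e) i 0) +
    x ^+ s * (\sum_l t i l * (y' * e l 0 - x ^+ s' * (t' *m e) l 0)).
  rewrite mulrBr mulrA (mulrC y') -addrA; congr (_ + _).
  under eq_bigr do rewrite mulrBr; rewrite sumrB mulrBr addrA.
  have -> : y' * (x ^+ s * (t *m e) i 0) = x ^+ s * \sum_l t i l * (y' * e l 0).
    rewrite mulrCA; congr (_ * _); rewrite mxE mulr_sumr; apply: eq_bigr => l _.
    by rewrite mulrCA.
  rewrite addNr add0r exprD -mulmxA mxE -mulrA mulr_sumr; congr (- (_ * _)).
  by apply: eq_bigr => l _; rewrite mulrCA.
apply: idealD.
  by rewrite -addnA addnCA; exact: SN.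
rewrite -addnA; apply: SN => //; apply: ideal_sum => l _; exact: idealMl.
Qed.

Lemma represents_scale s a y t : represents s y t -> represents s (a * y) (a *: t).
Proof.
move=> ht i; rewrite -scalemxAl mxE -mulrA (mulrCA (x ^+ s)) -mulrBr.
by apply: idealMl; exact: ht.
Qed.

Lemma represents_sum s (J : finType) (y : J -> R) (t : J -> 'M[R]_r) :
  (forall l, represents s (y l) (t l)) ->
  represents s (\sum_l y l) (\sum_l t l).
Proof.
move=> ht i; rewrite mulr_suml mulmx_suml summxE mulr_sumr -sumrB.
by apply: ideal_sum => l _; exact: ht.
Qed.

Lemma represents_exp s : represents s (x ^+ s) 1%:M.
Proof. by move=> i; rewrite mul1mx subrr; exact: ideal0. Qed.

Lemma represents_unit_surj y t z : S 1 y -> represents 1 y t ->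
  map_mx (residue m) t \in unitmx -> E j.+1 z ->
  exists2 z', E j z' & N j.+1 (z - y * z').
Proof.
move=> Sy ht tu Ez; have /choice[si hsi] : forall i : 'I_r * 'I_r,
    exists a, residue m a = invmx (map_mx (residue m) t) i.1 i.2.
  by move=> i; exact: residue_surj.
pose s : 'M[R]_r := \matrix_(i, l) si (i, l).
have st i l : m ((s *m t - 1%:M) i l).
  apply/residue_eq0; have : map_mx (residue m) (s *m t - 1%:M) = 0.
    rewrite map_mxB map_mxM map_mx1 (_ : map_mx _ s = invmx (map_mx (residue m) t)).
      by rewrite mulVmx // subrr.
    by apply/matrixP => a b; rewrite [LHS]mxE [s a b]mxE; exact: (hsi (a, b)).
  by move=> /matrixP/(_ i l); rewrite !mxE.
(* [c] holds the coordinates of [z] in terms of [x] times [e]; applying [s] undoes the action of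
   y/x. *)
have [_ /(_ _ Ez)[c Nc] _] := e_gen 1; exists ((c *m s *m e) 0 0).
  rewrite mxE; apply: ideal_sum => i _; apply: idealMl; exact: E_gen.
(* Three errors: that of [c], that of [t], and that of [s *m t - 1%:M], whose entries lie in [m] and
   are absorbed through [mEN]. *)
have -> : z - y * (c *m s *m e) 0 0 = z - x ^+ 1 * (c *m e) 0 0
   - \sum_i (c *m s) 0 i * (y * e i 0 - x ^+ 1 * (t *m e) i 0)
   - \sum_i (c *m (s *m t - 1%:M)) 0 i * (x ^+ 1 * e i 0).
  under eq_bigr do rewrite mulrBr; rewrite sumrB.
  have -> : \sum_i (c *m s) 0 i * (y * e i 0) = y * (c *m s *m e) 0 0.
    by rewrite mxE mulr_sumr; apply: eq_bigr => i _; rewrite mulrCA.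
  have -> : \sum_i (c *m s) 0 i * (x ^+ 1 * (t *m e) i 0) = x ^+ 1 * (c *m s *m t *m e) 0 0.
    by rewrite -(mulmxA (c *m s)) [in RHS]mxE mulr_sumr; apply: eq_bigr => i _; rewrite mulrCA.
  have -> : \sum_i (c *m (s *m t - 1%:M)) 0 i * (x ^+ 1 * e i 0) =
      x ^+ 1 * (c *m s *m t *m e) 0 0 - x ^+ 1 * (c *m e) 0 0.
    rewrite -mulrBr mulmxBr mulmx1 mulmxA.
    have -> : (c *m s *m t *m e) 0 0 - (c *m e) 0 0 = ((c *m s *m t - c) *m e) 0 0.
      by rewrite mulmxBl [RHS]mxE [X in _ = _ + X]mxE.
    by rewrite [in RHS]mxE mulr_sumr; apply: eq_bigr => i _; rewrite mulrCA.
  set a := y * _; set b := x ^+ 1 * _; set d := x ^+ 1 * _.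
  by ring.
rewrite -add1n; apply: idealD; first apply: idealD => //.
  by apply: idealN; apply: ideal_sum => i _; apply: idealMl.
apply: idealN; apply: ideal_sum => i _; apply: mEN; last by have [/(_ i)] := e_gen 1.
rewrite mxE; apply: ideal_sum => l _; exact: idealMl.
Qed.

End Represent.

Variables (k : nat) (W : finType) (d : nat) (q : W -> {mpoly (residue_field m)[k]}).
Variables (w : 'I_d -> W) (b : W -> R) (s0 : nat) (y0 : 'I_d -> R).
Hypothesis kinf : infinite_set [set: residue_field m].
Hypothesis qw : forall l, exists v, forall w', (q w').@[v] = (w' == w l)%:R.
Hypothesis Sb : forall w', S 1 (b w').
Hypothesis Sy0 : forall l, S s0 (y0 l).
Hypothesis x_dep : x ^+ s0.+1 = \sum_l b (w l) * y0 l.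

(** The matrices of the [b w'] commute because both products represent the same element. Divided by
    x^(s0+1), [x_dep] is the relation [generic_combination_unitmx] asks for, with the matrices of
    the [y0 l] as [C]. *)
Lemma generic_multiplication_surj : exists j, holds_generically (fun v =>
  forall z : W -> R, (forall w', residue m (z w') = (q w').@[v]) ->
  forall u, E j.+1 u ->
    exists2 u', E j u' & N j.+1 (u - (\sum_w' z w' * b w') * u')).
Proof.
have [j [r [e [_ e_gen]]]] := minimal_generators; exists j.
have /choice[t ht] w' := represents_ex e_gen (Sb w').
have /choice[c hc] l := represents_ex e_gen (Sy0 l).
have := @generic_combination_unitmx _ k W d q w kinf qw r
  (fun w' => map_mx (residue m) (t w')) (fun l => map_mx (residue m) (c l)).
case=> [l w'|l l'||p [p0 hp]].
- rewrite -!map_mxM; apply: (represents_uniq e_gen (s := 1 + 1) (y := b (w l) * b w')).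
    exact: represents_mul.
  by rewrite mulrC; exact: represents_mul.
- rewrite -!map_mxM; apply: (represents_uniq e_gen (s := 1 + s0) (y := b (w l) * y0 l')).
    exact: represents_mul.
  by rewrite mulrC addnC; exact: represents_mul.
- under eq_bigr do rewrite -map_mxM.
  rewrite -raddf_sum -(map_mx1 (residue m)).
  apply: (represents_uniq e_gen (s := 1 + s0) (y := x ^+ s0.+1)); last exact: represents_exp.
  rewrite x_dep; apply: represents_sum => l; exact: represents_mul.
exists p; split=> // v /hp tu z zq u Eu.
apply: (represents_unit_surj e_gen (t := \sum_w' z w' *: t w')) => //.
- by apply: ideal_sum => w' _; exact: idealMl.
- by apply: represents_sum => w'; exact: represents_scale.
- rewrite raddf_sum; move: tu; congr (_ \in unitmx); apply: eq_bigr => w' _.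
  by rewrite -zq; apply/esym/map_mxZ.
Qed.

End StableAction.

(** * Generic reductions of an ideal *)

Lemma ideal_add_is_ideal (R : comNzRingType) (I J : ideal R) :
  is_ideal [set z | exists2 u, I u & J (z - u)].
Proof.
split=> [|z t [u Iu Ju] [v Iv Jv]|a z [u Iu Ju]].
- by exists 0; rewrite ?subr0; exact: ideal0.
- exists (u + v); first exact: idealD.
  by rewrite opprD addrACA; exact: idealD.
- by exists (a * u); rewrite -?mulrBr; exact: idealMl.
Qed.

Definition ideal_add (R : comNzRingType) (I J : ideal R) : ideal R :=
  Ideal (ideal_add_is_ideal I J).

Lemma ideal_mul_expM (R : comNzRingType) (I K : ideal R) s t y z :
  ideal_exp I s y -> ideal_mul K (ideal_exp I t) z ->
  ideal_mul K (ideal_exp I (s + t)) (y * z).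
Proof.
move=> Iy Kz; rewrite mulrC; have := ideal_mulMr Kz Iy.
apply: ideal_mulSr; apply: ideal_mul_sub => u v Iu Iv.
by rewrite mulrC; exact: ideal_expM.
Qed.

(** The family [b] may exceed the generators [b \o w] of the reduction: a product of sums expands
    into more terms than the column products. *)
Lemma generic_reduction (R : comNzRingType) (m : max_ideal R) (I : ideal R)
    d (a : 'I_d.+1 -> R) (W : finType) (b : W -> R) d' (w : 'I_d' -> W)
    k (q : W -> {mpoly (residue_field m)[k]}) :
  noetherian R -> local_ring m -> infinite_set [set: residue_field m] ->
  reduction (ideal_gen (range a)) I ->
  (forall w', I (b w')) -> reduction (ideal_gen (range (b \o w))) I ->
  (forall l, exists v, forall w', (q w').@[v] = (w' == w l)%:R) ->
  holds_generically (fun v => forall z : W -> R,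
    (forall w', residue m (z w') = (q w').@[v]) ->
    forall L : ideal R, L `<=` I -> (forall j : 'I_d.+1, (j < d)%N -> L (a j)) ->
    L (\sum_w' z w' * b w') -> reduction L I).
Proof.
move=> Rnoeth Rloc kinf aI Ib [bI Ibw] qw.
have [j0 hj0] := reduction_exp Rnoeth aI.
have Ia j : I (a j) by apply: aI.1; apply: mem_ideal_gen; exists j.
pose A := ideal_gen [set a j | j in [set j : 'I_d.+1 | (j < d)%N]].
(* The shift by one makes room for A I^j in [N j]. *)
pose E j := ideal_exp I j.+1.
pose N j := ideal_add (ideal_mul m (E j)) (ideal_mul A (ideal_exp I j)).
(* Integrality of the last generator over the second reduction supplies [x_dep]. *)
have [n /mem_ideal_mul_gen[y Iy xE]] :=
  integral_exp_mem bI (Ia ord_max) (Ibw _ (Ia ord_max)).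
have [||||s|j j0j z|w'||j] := @generic_multiplication_surj R m (ideal_exp I) E N Rloc
  _ _ _ _ (a ord_max) j0 _ _ k W d' q w b n y kinf qw _ _ xE.
- by move=> s j u v Iu Ev; rewrite /E -addnS; exact: ideal_expM.
- move=> s j u z Iu [v mv Av]; exists (u * v).
    by rewrite /E -addnS; exact: ideal_mul_expM.
  by rewrite -mulrBr; exact: ideal_mul_expM.
- move=> j u z mu Ez; exists (u * z); first exact: mem_ideal_mul.
  by rewrite subrr; exact: ideal0.
- by move=> j; exact: noetherian_fg.
- exact: ideal_expX.
(* Beyond [j0], an element of I^(j+2) is a combination of the [a i] over I^(j+1); all terms but the
   last fall into A I^(j+1). *)
- move=> Ez; have jj : (j0 <= j.+1)%N by exact: leqW.
  have /mem_ideal_mul_gen[v Iv ->] := reduction_exp_stable hj0 jj Ez.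
  exists (v ord_max) => //; exists 0; first exact: ideal0.
  rewrite subr0 big_ord_recr addrK; apply: ideal_sum => i _.
  apply: mem_ideal_mul => //; apply: mem_ideal_gen.
  by exists (widen_ord (leqnSn d) i) => /=.
- exact: mem_ideal_exp1.
- exact: Iy.
apply: holds_generically_sub => v hv z zq L LI La Lg; split=> // x Ix.
(* Surjectivity shows that I^(j+2) lies in L I^(j+1) modulo m I^(j+2); Nakayama removes the error
   term. *)
apply: (@integral_of_exp_sub _ _ _ j.+1 x Rnoeth Ix).
apply: (local_nakayama Rloc Rnoeth) => t It.
have [u' Eu' [u mu Au]] := hv z zq t It.
exists (t - u); last by rewrite subKr.
rewrite -(subrK ((\sum_w' z w' * b w') * u') (t - u)).
apply: idealD; last exact: mem_ideal_mul.
rewrite addrAC; apply: ideal_mulSl Au; apply: ideal_gen_sub => _ [i ij <-].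
exact: La.
Qed.

(** * Generic complete reductions *)

Section CompleteReduction.
Variables (R : comNzRingType) (m : max_ideal R) (n d : nat).
Variables (I : 'I_n -> ideal R) (a b : 'M[R]_(n, d)).
Hypothesis Rnoeth : noetherian R.
Hypothesis Rloc : local_ring m.
Hypothesis kinf : infinite_set [set: residue_field m].
Hypothesis d_gt0 : (0 < d)%N.
Hypothesis aI : complete_reduction I a.
Hypothesis bI : complete_reduction I b.

(** Prescribing the residues of [Z] by polynomials [q i h] covers both claims: independent entries,
    and rows that all coincide. Columns count from 0, so [j.+1 < d] excludes just the last. *)
Lemma generic_complete_reduction k (q : 'I_n -> 'I_d -> {mpoly (residue_field m)[k]}) :
  (forall j, exists v, forall i h, (q i h).@[v] = (h == j)%:R) ->
  holds_generically (fun v => forall Z : 'M[R]_(n, d),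
    (forall i h, residue m (Z i h) = (q i h).@[v]) ->
    complete_reduction I (\matrix_(i < n, j < d)
      (if (j.+1 < d)%N then a i j else \sum_(h < d) Z i h * b i h))).
Proof.
case: d a b aI bI d_gt0 q => // d' a' b' [aIi aIr] [bIi bIr] _ q hq.
(* The product of the new last column expands over the functions [f] that pick a column in each row;
   constant functions give the column products of [b]. *)
pose W := {ffun 'I_n -> 'I_d'.+1}.
have := @generic_reduction R m (ideal_prod I) d' (fun j => \prod_i a' i j) W
  (fun f => \prod_i b' i (f i)) d'.+1 (fun j => [ffun=> j]) k (fun f => \prod_i q i (f i))
  Rnoeth Rloc kinf aIr.
case=> [f|||p [p0 hp]].
- by apply: mem_ideal_prod => i; exact: bIi.
- rewrite (_ : _ \o _ = fun j => \prod_i b' i j) //; apply/funext => j /=.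
  by apply: eq_bigr => i _; rewrite ffunE.
(* At a point where [q i h] is 1 for h = j and 0 otherwise, the product along [f] is 1 if [f] is
   constantly [j] and 0 if not. *)
- move=> j; have [v hv] := hq j; exists v => f; rewrite rmorph_prod /=.
  have [->|nf] := eqVneq; first by apply: big1 => i _; rewrite hv ffunE eqxx.
  have [i fi] : exists i, f i != j.
    apply/existsP; rewrite -negb_forall; apply: contraNN nf => /forallP h.
    by apply/eqP/ffunP => i; rewrite ffunE; apply/eqP.
  by rewrite (bigD1 i) //= hv (negPf fi) mul0r.
exists p; split=> // v /hp hv Z Zq.
have memI i j : I i ((\matrix_(i < n, j < d'.+1)
    (if (j.+1 < d'.+1)%N then a' i j else \sum_(h < d'.+1) Z i h * b' i h)) i j).
  rewrite mxE; case: ifP => _; first exact: aIi.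
  by apply: ideal_sum => h _; apply: idealMl; exact: bIi.
split=> //; apply: (hv (fun f => \prod_i Z i (f i))) => [f|||].
- by rewrite !rmorph_prod; apply: eq_bigr => i _; exact: Zq.
- apply: ideal_gen_sub => _ [j _ <-]; exact: mem_ideal_prod.
- move=> j jd; apply: mem_ideal_gen; exists j => //.
  by apply: eq_bigr => i _; rewrite mxE ltnS jd.
- apply: mem_ideal_gen; exists ord_max => //.
  under eq_bigr do rewrite mxE ltnn.
  rewrite bigA_distr_bigA; apply: eq_bigr => f _.
  by rewrite big_split.
Qed.

End CompleteReduction.

Theorem theorem6p1 (R : comNzRingType) (m : max_ideal R) (n d : nat)
    (I : 'I_n -> ideal R) (a b : 'M[R]_(n, d)) :
  noetherian R ->
  local_ring m ->
  infinite_set [set: residue_field m] ->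
  analytic_spread_eq m (ideal_prod I) d ->
  (1 <= d)%N ->
  complete_reduction I a ->
  complete_reduction I b ->
  almost_all_mx m [set Z : 'M[R]_(n, d) |
    complete_reduction I
      (\matrix_(i < n, j < d)
         (if (j.+1 < d)%N then a i j else \sum_(h < d) Z i h * b i h))]
  /\
  almost_all_vec m [set u : 'rV[R]_d |
    complete_reduction I
      (\matrix_(i < n, j < d)
         (if (j.+1 < d)%N then a i j else \sum_(h < d) u 0 h * b i h))].
Proof.
move=> Rnoeth Rloc kinf _ d_gt0 aI bI.
(* The exceptional set is the zero locus of one polynomial, proper because of the point where it
   does not vanish. *)
have generic_proper N (B : ('I_N -> residue_field m) -> Prop) : holds_generically B ->
    exists M : set 'rV[residue_field m]_N, [/\ zariski_closed M, M `<` setT &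
      forall v : 'rV_N, ~ M v -> B (fun i => v 0 i)].
  move=> [p [[v pv] pB]]; exists [set v : 'rV_N | p.@[fun i => v 0 i] = 0]; split.
  - by exists [set p]; apply/seteqP; split=> [u pu _ ->|u]; [exact: pu|exact].
  - split=> // /(_ (\row_i v i) Logic.I) /= /eqP; apply/negP.
    by rewrite (@meval_eq _ _ _ v) // => i; rewrite mxE.
  - by move=> u /eqP; exact: pB.
split.
(* One variable per entry, indexed as in [mxvec]; the test point has ones exactly in column [j]. *)
- have [j|M [Mclosed MT hM]] := generic_proper _ _ (generic_complete_reduction
    Rnoeth Rloc kinf d_gt0 aI bI (q := fun i h => 'X_(mxvec_index i h)) _).
    exists (fun l => mxvec (\matrix_(i < n, h < d) (h == j)%:R) 0 l) => i h.
    by rewrite mevalXU mxvecE mxE.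
  exists M; split=> // Z /hM; apply=> i h.
  by rewrite mevalXU mxvecE mxE.
(* All rows share the variables ['X_h], so [Z] is the matrix with every row equal to [u]. *)
- have [j|M [Mclosed MT hM]] := generic_proper _ _ (generic_complete_reduction
    Rnoeth Rloc kinf d_gt0 aI bI (q := fun _ h => 'X_h) _).
    by exists (fun h => (h == j)%:R) => i h; rewrite mevalXU.
  exists M; split=> // u /hM/(_ (\matrix_(i, h) u 0 h)) hu /=.
  rewrite (_ : \matrix_(i, j) _ = \matrix_(i < n, j < d) (if (j.+1 < d)%N then a i j
    else \sum_(h < d) (\matrix_(i < n, h < d) u 0 h) i h * b i h)).
    by apply: hu => i h; rewrite mevalXU !mxE.
  apply/matrixP => i j; rewrite !mxE; case: ifP => // _.
  by apply: eq_bigr => h _; rewrite mxE.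
Qed.
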